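(* For every $n$ and every decomposition $[\mathsf{K}^c_n,P]$ of the complete convex geometric graph $\mathsf{K}^c_n$ such that each member of $P$ is a triangle, \[\chi'([\mathsf{K}^c_n,P])\geq \frac{n^{2}}{119}-O(n).\]
   Context: $\mathsf{K}^c_n$ denotes the complete geometric graph whose $n$ vertices are points in convex position (the vertices of a convex polygon, e.g. a regular $n$-gon) and whose edges are all $\binom n2$ straight-line segments between them. A decomposition $[G,P]$ of a graph $G$ is a set $P$ of non-empty induced subgraphs of $G$ such that every edge of $G$ belongs to exactly one member of $P$; a triangle is a complete subgraph on $3$ vertices. Two geometric graphs have nonempty intersection if they share a vertex or some edge of one crosses some edge of the other. A $k$-$P$-coloring assigns to each edge one of $k$ colors so that all edges of each member of $P$ get the same color and any two members of $P$ with nonempty intersection get different colors; the chromatic index $\chi'([\mathsf{K}^c_n,P])$ is the least such $k$. *)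

(* Defs.v *)
From mathcomp Require Import all_boot all_order all_algebra.
From mathcomp Require Import boolp reals.

Set Implicit Arguments.
Unset Strict Implicit.
Unset Printing Implicit Defensive.

Import Order.TTheory GRing.Theory Num.Theory.
Local Open Scope ring_scope.

(* A geometric graph is given by a finite type V of vertices, their positions
   pos : V -> 'rV[R]_2, and a set E of edges, each edge being the 2-element
   set of its endpoints, drawn as a straight-line segment. *)

Section Geometry.
Variables (R : realType) (V : finType) (pos : V -> 'rV[R]_2).

Definition in_conv_hull (S : {set V}) (x : 'rV[R]_2) : Prop :=
  exists w : V -> R,
    [/\ forall v, v \in S -> 0 <= w v, \sum_(v in S) w v = 1 &
        x = \sum_(v in S) w v *: pos v].

(* The positions are the vertices of a convex polygon. This entails that they
   are pairwise distinct and that no three of them are collinear. *)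
Definition convex_position : Prop :=
  forall v, ~ in_conv_hull [set~ v] (pos v).

Definition in_open_segment (e : {set V}) (x : 'rV[R]_2) : Prop :=
  exists u v (t : R), [/\ u != v, e = [set u; v], 0 < t < 1 &
    x = (1 - t) *: pos u + t *: pos v].

Definition edges_cross (e f : {set V}) : Prop :=
  e <> f /\ exists x, in_open_segment e x /\ in_open_segment f x.

End Geometry.

Definition complete_edges (V : finType) : {set {set V}} :=
  [set e : {set V} | #|e| == 2%N].

Section Decomposition.
Variables (V : finType) (E : {set {set V}}).

(* An induced subgraph of (V, E) is represented by its vertex set. *)
Definition induced_edges (A : {set V}) : {set {set V}} :=
  [set e in E | e \subset A].

Definition is_decomposition (P : {set {set V}}) : Prop :=
  set0 \notin P /\
  forall e, e \in E -> #|[set A in P | e \in induced_edges A]| = 1%N.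

Definition is_triangle (A : {set V}) : Prop :=
  #|A| = 3%N /\ forall u v, u \in A -> v \in A -> u != v -> [set u; v] \in E.

End Decomposition.

Section Coloring.
Variables (R : realType) (V : finType) (pos : V -> 'rV[R]_2).
Variables (E P : {set {set V}}).

Definition members_meet (A B : {set V}) : Prop :=
  (exists v, v \in A /\ v \in B) \/
  (exists e f, [/\ e \in induced_edges E A, f \in induced_edges E B &
                   edges_cross pos e f]).

(* Only the values of c on E matter. *)
Definition is_P_coloring (k : nat) (c : {set V} -> nat) : Prop :=
  [/\ forall e, e \in E -> (c e < k)%N,
      forall A, A \in P -> {in induced_edges E A &, forall e f, c e = c f} &
      forall A B, A \in P -> B \in P -> A <> B -> members_meet A B ->
        {in induced_edges E A & induced_edges E B, forall e f, c e <> c f}].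

Definition P_colorable (k : nat) : Prop := exists c, is_P_coloring k c.

Lemma P_colorable_exists :
  is_decomposition E P -> exists k, `[< P_colorable k >].
Proof.
move=> [_ dP].
have uniqP e A B : A \in P -> B \in P -> e \in induced_edges E A ->
    e \in induced_edges E B -> A = B.
  move=> PA PB eA eB; have eE : e \in E by move: eA; rewrite inE => /andP[].
  have /eqP/cards1P[D defD] := dP e eE.
  have : A \in [set D] by rewrite -defD inE PA eA.
  have : B \in [set D] by rewrite -defD inE PB eB.
  by move=> /set1P -> /set1P ->.
pose m e := odflt set0 [pick A in P | e \in induced_edges E A].
have mE e A : A \in P -> e \in induced_edges E A -> m e = A.
  move=> PA eA; rewrite /m; case: pickP => [B /andP[PB eB]|/(_ A)] /=.
    exact: uniqP PB PA eB eA.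
  by rewrite PA eA.
exists #|{set V}|; apply/asboolP; exists (fun e => enum_rank (m e) : nat).
split=> [e _|A PA e f eA fA|A B PA PB nAB _ e f eA fB].
- exact: ltn_ord.
- by rewrite (mE e A) ?(mE f A).
- by rewrite (mE e A) ?(mE f B) // => /val_inj/enum_rank_inj.
Qed.

Definition chromatic_index (dP : is_decomposition E P) : nat :=
  ex_minn (P_colorable_exists dP).

End Coloring.

(* Main.v *)
(* Order the vertices cyclically, r being the resulting rank, and put
   L = n %/ 11 + 1. Every short edge (of rank difference < L) lies in a single
   triangle, so at most n(L - 1) <= n^2 / 11 triangles have a short edge. A
   color class of triangles without short edges is a noncrossing family, and m
   noncrossing disjoint triangles with all gaps >= L span at least (m + 1)L
   ranks; as 11 L > n, this gives m <= 9. Since there are n(n - 1) / 6 triangles,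
   the number of colors is at least (n(n - 1) / 6 - n^2 / 11) / 9
   >= 5 n^2 / 594 - n, and 5 * 119 >= 594. *)
Require Import Defs.
From mathcomp Require Import all_boot all_order all_algebra.
From mathcomp Require Import boolp reals.
From mathcomp Require Import zify ring lra.
Import Order.TTheory GRing.Theory Num.Theory.
Local Open Scope ring_scope.

Set Implicit Arguments.
Unset Strict Implicit.
Unset Printing Implicit Defensive.

(** * Orientations, and a linear order on points in convex position *)

Section ConvexPosition.
Variables (R : realType) (V : finType) (pos : V -> 'rV[R]_2).
Hypothesis convp : convex_position pos.

Let X (v : V) : R := pos v 0 0.
Let Y (v : V) : R := pos v 0 1.

Lemma row2P (x y : 'rV[R]_2) : x 0 0 = y 0 0 -> x 0 1 = y 0 1 -> x = y.
Proof.
move=> e0 e1; apply/rowP => i; have [->|->] // : i = 0 \/ i = 1.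
by case: i => [[|[|//]] ?]; [left|right]; apply/val_inj.
Qed.

(** Dividing by [a + b + c] puts [o] in the convex hull of other vertices. The points [u], [v], [w]
    may coincide, so degenerate hulls (a segment, a point) are covered too. *)
Lemma convex_position_combination (o u v w : V) (a b c : R) :
  u != o -> v != o -> w != o -> 0 <= a -> 0 <= b -> 0 <= c -> 0 < a + b + c ->
  a * (X u - X o) + b * (X v - X o) + c * (X w - X o) = 0 ->
  a * (Y u - Y o) + b * (Y v - Y o) + c * (Y w - Y o) = 0 -> False.
Proof.
move=> uo vo wo a0 b0 c0 s0 eX eY; apply: (convp (v := o)).
pose s := a + b + c.
pose wt y := ((y == u)%:R * a + (y == v)%:R * b + (y == w)%:R * c) / s.
have sumwt (f : V -> R) :
    \sum_(y in [set~ o]) wt y * f y = (a * f u + b * f v + c * f w) / s.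
  have pick z d : z != o -> \sum_(y in [set~ o]) (y == z)%:R * d * f y = d * f z.
    move=> zo; rewrite (bigD1 z) ?inE //= eqxx mul1r big1 ?addr0 // => y.
    by case/andP=> _ /negPf->; rewrite !mul0r.
  rewrite -(pick u) // -(pick v) // -(pick w) // -!big_split mulr_suml /=.
  by apply: eq_bigr => y _; rewrite /wt; ring.
have sn0 : s != 0 by rewrite gt_eqF.
exists wt; split.
- move=> y _; apply: divr_ge0; last exact: ltW.
  by apply: addr_ge0; first apply: addr_ge0; apply: mulr_ge0; rewrite ?ler0n.
- have := sumwt (fun=> 1); under eq_bigr do rewrite mulr1.
  by move=> ->; rewrite !mulr1 divff.
- apply: row2P; rewrite summxE; under eq_bigr do rewrite mxE.
    rewrite sumwt; apply: (canRL (mulfK sn0)); rewrite -/(X _) /s; move: eX.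
    by rewrite /X; lra.
  rewrite sumwt; apply: (canRL (mulfK sn0)); rewrite /s; move: eY.
  by rewrite /Y; lra.
Qed.

(** Twice the signed area of the triangle [a b c], positive when it runs counterclockwise. *)
Definition orient (a b c : V) : R :=
  (X b - X a) * (Y c - Y a) - (Y b - Y a) * (X c - X a).

Lemma det2_eq0 (px py qx qy : R) : px * qy - py * qx = 0 ->
  (qx != 0) || (qy != 0) -> exists2 t, px = t * qx & py = t * qy.
Proof.
move/eqP; rewrite subr_eq0 => /eqP e; case: (eqVneq qx 0) => [x0|x0] /= q0.
  exists (py / qy); rewrite ?divfK //; apply: (mulIf q0).
  by rewrite e x0 !mulr0 mul0r.
exists (px / qx); rewrite ?divfK //; apply: (mulIf x0).
by rewrite mulrAC divfK // e.
Qed.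

Lemma orient_neq0 (o u v : V) : u != o -> v != o -> u != v -> orient o u v != 0.
Proof.
move=> uo vo uv; apply/negP => /eqP e.
have q0 : (X v - X o != 0) || (Y v - Y o != 0).
  rewrite -negb_and; apply/negP => /andP[/eqP x0 /eqP y0].
  by apply: (@convex_position_combination o v v v 1 0 0) => //;
    rewrite ?x0 ?y0; lra.
have [t tx ty] := det2_eq0 e q0.
(* On the common line, [t] tells which point lies between the other two: [o], then [u], then [v]. *)
case: (lerP t 0) => t0; last case: (lerP t 1) => t1.
- by apply: (@convex_position_combination o u v v 1 (- t) 0) => //; lra.
- by apply: (@convex_position_combination u o v v (1 - t) t 0);
    rewrite // 1?eq_sym //; lra.
- by apply: (@convex_position_combination v u o o 1 (t - 1) 0);
    rewrite // 1?eq_sym //; lra.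
Qed.

(** The vectors from [o] to [u], [v], [w] satisfy a linear relation with coefficients
    [orient o v w], [- orient o u w], [orient o u v]. If the claim failed, these would place [o] in
    the hull of the other three. *)
Lemma orient_trans (o u v w : V) : u != o -> v != o -> w != o ->
  0 < orient o u v -> 0 < orient o v w -> 0 < orient o u w.
Proof.
move=> uo vo wo uv vw; rewrite ltNge; apply/negP => wu.
apply: (@convex_position_combination o u v w
  (orient o v w) (- orient o u w) (orient o u v)) => //; try by lra.
- by rewrite /orient; ring.
- by rewrite /orient; ring.
Qed.

(** Same linear relation, now based at [b]: otherwise [b] would lie in the hull of [a], [c], [o]. *)
Lemma orient_convex (o a b c : V) : a != b -> c != b -> o != b ->
  0 < orient o a b -> 0 < orient o b c -> 0 < orient o a c -> 0 < orient a b c.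
Proof.
move=> ab cb ob oab obc oac; rewrite ltNge; apply/negP => abc.
apply: (@convex_position_combination b a c o
  (orient o b c) (orient o a b) (- orient a b c)) => //; try by lra.
- by rewrite /orient; ring.
- by rewrite /orient; ring.
Qed.

(* The vertex [o] comes first, then the others counterclockwise as seen from [o];
   by convexity they span an angle < pi there, so this is a linear order. *)
Definition angle_lt (o u v : V) : bool :=
  (v != o) && ((u == o) || (0 < orient o u v)).

Lemma orientC (o u v : V) : orient o u v = - orient o v u.
Proof. by rewrite /orient; ring. Qed.

Lemma orient_id (o u : V) : orient o u u = 0.
Proof. by rewrite /orient; ring. Qed.

Lemma angle_lt_irr (o u : V) : angle_lt o u u = false.
Proof.
by rewrite /angle_lt orient_id ltxx orbF; case: eqP.
Qed.

Lemma angle_lt_trans (o : V) : transitive (angle_lt o).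
Proof.
move=> v u w /andP[vo uv] /andP[wo vw]; rewrite /angle_lt wo /=.
case: (eqVneq u o) uv => //= uo uv; move: vw; rewrite (negPf vo) /=.
exact: orient_trans uv.
Qed.

Lemma angle_lt_total (o u v : V) : u != v -> angle_lt o u v || angle_lt o v u.
Proof.
move=> uv; rewrite /angle_lt; case: (eqVneq u o) => [uo|uo] /=.
  by rewrite -uo eq_sym uv.
case: (eqVneq v o) => //= vo; have := orient_neq0 uo vo uv.
by rewrite neq_lt (orientC o v u) oppr_gt0 orbC.
Qed.

Lemma angle_lt_neq (o u v : V) : angle_lt o u v -> u != v.
Proof. by apply: contraTneq => ->; rewrite angle_lt_irr. Qed.

Lemma angle_lt_orient (o a b c : V) :
  angle_lt o a b -> angle_lt o b c -> 0 < orient a b c.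
Proof.
move=> ab bc; have ac := angle_lt_trans ab bc.
have [nab nbc] := (angle_lt_neq ab, angle_lt_neq bc).
move: ab bc ac; rewrite /angle_lt => /andP[bo ab] /andP[co].
rewrite (negPf bo) co /=.
case: eqP ab => [-> //|_ /= ab bc ac].
by apply: orient_convex ab bc ac; rewrite // eq_sym.
Qed.

Lemma orient_cross (a b c d : V) : a != c -> b != d ->
  0 < orient a b c -> 0 < orient a c d -> 0 < orient a b d -> 0 < orient b c d ->
  exists x, in_open_segment pos [set a; c] x /\ in_open_segment pos [set b; d] x.
Proof.
move=> nac nbd abc acd abd bcd.
(* [s] is twice the area of the quadrilateral [a b c d]. By Cramer's rule the diagonals meet at
   parameter [t] on [a c] and [t'] on [b d]. *)
pose s := orient a b c + orient a c d.
have s0 : 0 < s by rewrite addr_gt0.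
have abds : orient a b d < s.
  by rewrite -subr_gt0 (_ : _ - _ = orient b c d) // /s /orient; ring.
pose t := orient a b d / s; pose t' := orient a b c / s.
have sn0 : s != 0 by rewrite gt_eqF.
exists ((1 - t) *: pos a + t *: pos c); split.
  by exists a, c, t; split; rewrite // /t divr_gt0 //= ltr_pdivrMr ?mul1r.
exists b, d, t'; split; rewrite //.
  by rewrite /t' divr_gt0 //= ltr_pdivrMr ?mul1r // /s ltrDl.
have lin p q z : ((1 - z) * p + z * q) * s = (s - z * s) * p + z * s * q by ring.
by apply: row2P; rewrite !mxE; apply: (mulIf sn0);
  rewrite !lin /t /t' !divfK // /s /orient /X /Y; ring.
Qed.

Lemma angle_lt_cross (o a b c d : V) :
  angle_lt o a b -> angle_lt o b c -> angle_lt o c d ->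
  edges_cross pos [set a; c] [set b; d].
Proof.
move=> ab bc cd; have [ac bd] := (angle_lt_trans ab bc, angle_lt_trans bc cd).
split.
  move=> /setP/(_ a); rewrite !inE eqxx (negPf (angle_lt_neq ab)).
  by rewrite (negPf (angle_lt_neq (angle_lt_trans ac cd))).
by apply: orient_cross; rewrite ?(@angle_lt_neq o) ?(@angle_lt_orient o).
Qed.

End ConvexPosition.

(** The rank of a vertex counts its predecessors for [angle_lt] at a base vertex. This reduces the
    geometry to interleaving of ranks. *)
Lemma convex_position_order (R : realType) (V : finType) (pos : V -> 'rV[R]_2) :
  convex_position pos ->
  exists r : V -> nat, [/\ injective r, forall v, (r v < #|V|)%N &
    forall a b c d, (r a < r b < r c)%N -> (r c < r d)%N ->
      edges_cross pos [set a; c] [set b; d]].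
Proof.
move=> convp; case: (pickP (@predT V)) => [o _|V0]; last first.
  by exists (fun=> 0%N); split=> [v|v|v]; have := V0 v.
pose lt := angle_lt pos o.
have lt_trans : transitive lt by exact: angle_lt_trans.
pose r v := #|[set u | lt u v]|.
have r_homo u v : lt u v -> (r u < r v)%N.
  move=> uv; apply: proper_card; apply/properP; split.
    by apply/subsetP => w; rewrite !inE => /lt_trans; apply.
  by exists u; rewrite inE ?uv // /lt angle_lt_irr.
have r_inj : injective r.
  move=> u v ruv; apply/eqP/negPn/negP => /(angle_lt_total convp o).
  by case/orP => /r_homo; rewrite ruv ltnn.
have r_mono u v : (r u < r v)%N -> lt u v.
  move=> ruv; have uv : u != v by apply: contraTneq ruv => ->; rewrite ltnn.
  have /orP[//|/r_homo] := angle_lt_total convp o uv.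
  by rewrite ltnNge (ltnW ruv).
exists r; split=> // [v|a b c d /andP[/r_mono ab /r_mono bc] /r_mono cd].
  rewrite /r -cardsT; apply: proper_card; apply/properP; split=> //.
  by exists v; rewrite ?inE // /lt angle_lt_irr.
exact: angle_lt_cross ab bc cd.
Qed.

(** * Combinatorics of ranks: noncrossing families and short edges *)

Section LongTriangles.
Local Open Scope nat_scope.
Variables (V : finType) (r : V -> nat).
Hypothesis r_inj : injective r.

Lemma card3_sorted (A : {set V}) : #|A| = 3 ->
  exists i j k, [/\ A = [set i; j; k], r i < r j & r j < r k].
Proof.
pose le u v := r u <= r v; move=> A3.
have s_sorted : sorted le (sort le (enum A)).
  by apply: sort_sorted => u v; apply: leq_total.
have : uniq (sort le (enum A)) by rewrite sort_uniq enum_uniq.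
have : size (sort le (enum A)) = 3 by rewrite size_sort -cardE.
have memA : sort le (enum A) =i A by move=> v; rewrite mem_sort mem_enum.
case: (sort le (enum A)) s_sorted memA => [|i [|j [|k []]]] //=.
rewrite /le !inE !andbT => /andP[ij jk] memA _ /andP[/norP[nij _] njk].
exists i, j, k; split.
- by apply/setP => v; rewrite -memA !inE orbA.
- by rewrite ltn_neqAle ij (inj_eq r_inj) nij.
- by rewrite ltn_neqAle jk (inj_eq r_inj) njk.
Qed.

Definition gaps_ge (L : nat) (A : {set V}) : bool :=
  [forall u in A, forall v in A, (r u < r v) ==> (r u + L <= r v)].

Lemma gaps_geP (L : nat) (A : {set V}) :
  reflect {in A &, forall u v, r u < r v -> r u + L <= r v} (gaps_ge L A).
Proof.
apply: (iffP 'forall_in_'forall_in_implyP) => [H u v uA vA|H u uA v vA];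
  exact: H.
Qed.

(** The interleaving starts in [A], so the relation is not symmetric; noncrossing is assumed below
    for ordered pairs. *)
Definition rank_cross (A B : {set V}) : Prop :=
  exists a b c d, [/\ [/\ a \in A, b \in B, c \in A & d \in B],
                      r a < r b < r c & r c < r d].

(* The triangle [i < j < k] reaching furthest to the left splits the others into
   those lying in the gaps (i, j) and (j, k) and those lying to the right of k. *)
Lemma noncrossing_span (L : nat) (F : {set {set V}}) (x y : nat) :
  {in F, forall A : {set V}, #|A| = 3} -> {in F, forall A, gaps_ge L A} ->
  (forall A B : {set V}, A \in F -> B \in F -> A != B ->
     [disjoint A & B] /\ ~ rank_cross A B) ->
  (forall (A : {set V}) v, A \in F -> v \in A -> x <= r v <= y) ->
  0 < #|F| -> L * #|F|.+1 + x <= y.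
Proof.
have [m] := ubnP #|F|; elim: m => // m IHm in F x y * => ltFm F3 FL Fd Fxy F0.
have [A0 A0F] : exists A0, A0 \in F by apply/set0Pn; rewrite -card_gt0.
have [v0 v0A] : exists v0, v0 \in A0 by apply/set0Pn; rewrite -card_gt0 F3.
have v0F : v0 \in cover F by apply/bigcupP; exists A0.
case: (arg_minnP r v0F) => i0 /bigcupP[T TF i0T] i0min.
have [i [j [k [Tijk ij jk]]]] := card3_sorted (F3 T TF).
have iT : i \in T by rewrite Tijk !inE eqxx.
have jT : j \in T by rewrite Tijk !inE eqxx orbT.
have kT : k \in T by rewrite Tijk !inE eqxx !orbT.
have i_min A v : A \in F -> v \in A -> r i <= r v.
  move=> AF vA; apply: (@leq_trans (r i0)).
    move: i0T; rewrite Tijk !inE => /orP[/orP[]|] /eqP -> //; first exact: ltnW.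
    exact: ltnW (ltn_trans ij jk).
  by apply: i0min; apply/bigcupP; exists A.
pose G a b := [set A in F :\ T | [forall v in A, a < r v < b]].
(* The induction hypothesis on a window. The [minn] serves both the gaps inside [T], which end at
   [b], and the open window up to [y.+1], whose ranks end at [y]. *)
have G_span a b : a < b -> 0 < #|G a b| -> b <= y.+1 ->
    L * #|G a b|.+1 + a <= minn b y.
  move=> ab G0 by_.
  have GF : {subset G a b <= F} by move=> A; rewrite !inE => /andP[/andP[]].
  apply: IHm => //.
  - apply: leq_trans (ltFm : #|F| <= m); rewrite (cardsD1 T F) TF add1n ltnS.
    by apply/subset_leq_card/subsetP => A; rewrite inE => /andP[].
  - by move=> A /GF /F3.
  - by move=> A /GF /FL.
  - by move=> A B /GF AF /GF BF; apply: Fd.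
  - move=> A v AG vA; have := AG; rewrite inE => /andP[_ /forall_inP/(_ v vA)].
    by have /andP[_ vy] := Fxy A v (GF _ AG) vA; case/andP=> av vb;
      rewrite leq_min vy (ltnW av) (ltnW vb).
have F_le : #|F| <= 1 + #|G (r i) (r j)| + #|G (r j) (r k)| + #|G (r k) y.+1|.
  have sF : F \subset [set T] :|: G (r i) (r j) :|: G (r j) (r k) :|: G (r k) y.+1.
    apply/subsetP => B BF; rewrite 3!inE in_set1.
    have [//|nBT] /= := eqVneq B T.
    have [dTB ncross] : [disjoint T & B] /\ ~ rank_cross T B.
      by apply: Fd; rewrite // eq_sym.
    have neT z v : z \in T -> v \in B -> r z != r v.
      move=> zT vB; rewrite (inj_eq r_inj); apply: contraTneq vB => <-.
      by rewrite (disjointFr dTB zT).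
    have [b bB bmin] : exists2 b, b \in B & forall v, v \in B -> r b <= r v.
      have [b0 b0B] : exists b0, b0 \in B by apply/set0Pn; rewrite -card_gt0 F3.
      by case: (arg_minnP r b0B) => b bB bmin; exists b.
    have bounds v : v \in B -> [/\ r i < r v, r j != r v, r k != r v & r v <= y].
      move=> vB; have /andP[_ ?] := Fxy _ _ BF vB.
      by split; rewrite ?neT // ltn_neqAle neT // (i_min B).
    (* If [B] starts before a vertex [z] of [T] and continues past it, then [i], [b], [z], [v]
       interleave. Hence [B] stays in the window where it starts. *)
    have no_jump z v : z \in T -> v \in B -> r i < r z -> r b < r z -> r v < r z.
      move=> zT vB iz bz; rewrite ltn_neqAle eq_sym neT //= leqNgt.
      apply/negP => zv; apply: ncross; exists i, b, z, v; split=> //.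
      by rewrite bz andbT; have [] := bounds b bB.
    have in_gap a c : (forall v, v \in B -> a < r v < c) -> B \in G a c.
      by move=> H; rewrite inE !inE nBT BF; apply/forall_inP.
    have [_ nj nk _] := bounds b bB.
    case: (ltnP (r b) (r j)) => bj.
      rewrite in_gap // => v vB; have [-> _ _ _] := bounds v vB.
      exact: no_jump.
    case: (ltnP (r b) (r k)) => bk.
      rewrite (in_gap (r j)) ?orbT // => v vB; have [_ njv _ _] := bounds v vB.
      rewrite ltn_neqAle njv (leq_trans bj (bmin v vB)).
      exact: no_jump (ltn_trans ij jk) bk.
    rewrite (in_gap (r k)) ?orbT // => v vB; have [_ _ nkv vy] := bounds v vB.
    by rewrite ltn_neqAle nkv (leq_trans bk (bmin v vB)).
  apply: leq_trans (subset_leq_card sF) _.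
  do 3!(apply: leq_trans (leq_card_setU _ _) _; rewrite leq_add2r).
  by rewrite cards1.
have /andP[xi _] := Fxy T i TF iT.
have /andP[_ ky] := Fxy T k TF kT.
have TL := gaps_geP _ _ (FL T TF).
have Lij := TL i j iT jT ij; have Ljk := TL j k jT kT jk.
(* An empty gap still has length at least [L]. So gaps holding [g1] and [g2] members have lengths at
   least [L * g1.+1] and [L * g2.+1], and the last window, with [g3] members, at least [L * g3]. As
   [#|F| <= 1 + g1 + g2 + g3], the sum is at least [L * #|F|.+1]. *)
have S1 : L * #|G (r i) (r j)|.+1 + r i <= r j.
  have [->|] := posnP #|G (r i) (r j)|; first by rewrite muln1 addnC.
  move/(G_span _ _ ij); rewrite leq_min => /(_ _)/andP[] //.
  exact: leqW (leq_trans (ltnW jk) ky).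
have S2 : L * #|G (r j) (r k)|.+1 + r j <= r k.
  have [->|] := posnP #|G (r j) (r k)|; first by rewrite muln1 addnC.
  by move/(G_span _ _ jk); rewrite leq_min => /(_ (leqW ky))/andP[].
have S3 : L * #|G (r k) y.+1| + r k <= y.
  have [->|] := posnP #|G (r k) y.+1|; first by rewrite muln0.
  move/(G_span _ _ (ky : r k < y.+1)); rewrite leq_min => /(_ (leqnn _))/andP[_].
  by rewrite mulnS; clear; lia.
have := leq_mul (leqnn L) F_le; rewrite !mulnDr muln1.
by move: S1 S2 S3 xi; rewrite !mulnS; clear; lia.
Qed.

Lemma card_short_members (P : {set {set V}}) (D : nat) :
  (forall A B u v, A \in P -> B \in P -> u != v ->
     u \in A -> v \in A -> u \in B -> v \in B -> A = B) ->
  #|[set A in P | ~~ gaps_ge D.+1 A]| <= #|V| * D.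
Proof.
move=> uniqP.
(* A short member is recovered from the lower endpoint of a short edge and the rank difference minus
   one, which takes [D] values; the default [set0] is harmless for an upper bound. *)
pose g (p : V * 'I_D) := odflt set0 [pick A in P |
  (p.1 \in A) && [exists v in A, r v == r p.1 + p.2.+1]].
rewrite -[D in _ * D]card_ord -card_prod -cardsT.
apply: leq_trans (leq_imset_card g _); apply/subset_leq_card/subsetP => A.
rewrite inE => /andP[AP /forall_inPn[u uA /forall_inPn[v vA]]].
rewrite negb_imply -ltnNge => /andP[uv vD].
have dD : r v - r u - 1 < D by lia.
have vE : r v = r u + (r v - r u - 1).+1 by lia.
apply/imsetP; exists (u, Ordinal dD) => //; rewrite /g /=.
case: pickP => [B /and3P[BP uB /exists_inP[w wB]]|/(_ A)] /=.
  rewrite -vE (inj_eq r_inj) => /eqP wv; rewrite wv in wB.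
  by apply: uniqP AP BP _ uA vA uB wB; apply: contraTneq uv => ->; rewrite ltnn.
by rewrite AP uA /= => /exists_inP[]; exists v => //; rewrite -vE.
Qed.

End LongTriangles.

(** * Counting the triangles of a decomposition *)

Section Counting.
Local Open Scope nat_scope.
Variables (V : finType) (P : {set {set V}}).
Hypothesis dP : is_decomposition (complete_edges V) P.
Hypothesis P3 : {in P, forall A : {set V}, #|A| = 3}.

Lemma decomposition_uniq (A B : {set V}) u v : A \in P -> B \in P -> u != v ->
  u \in A -> v \in A -> u \in B -> v \in B -> A = B.
Proof.
move=> AP BP uv uA vA uB vB; case: dP => _ /(_ [set u; v]).
have eE : [set u; v] \in complete_edges V by rewrite inE cards2 uv.
move=> /(_ eE)/eqP/cards1P[C CE].
have sub (D : {set V}) : u \in D -> v \in D -> [set u; v] \subset D.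
  by move=> uD vD; apply/subsetP => w /set2P[] ->.
have : A \in [set C] by rewrite -CE !inE AP cards2 uv sub.
have : B \in [set C] by rewrite -CE !inE BP cards2 uv sub.
by move=> /set1P -> /set1P ->.
Qed.

(** Double counting of pairs of an edge and a member containing it. *)
Lemma card_triangle_decomposition : 3 * #|P| = 'C(#|V|, 2).
Proof.
rewrite -card_draws -[RHS]sum1_card mulnC -sum_nat_const.
transitivity (\sum_(e in complete_edges V) \sum_(A in P | e \subset A) 1).
  rewrite (exchange_big_dep (mem P)) /=; last by move=> ? ? _ /andP[].
  apply: eq_bigr => A AP; have <- : 'C(#|A|, 2) = 3 by rewrite P3.
  rewrite -cards_draws -sum1_card; apply: eq_bigl => e.
  by rewrite !inE AP /= andbC.
apply: eq_bigr => e eE; rewrite sum1_card; have [_ /(_ e eE) <-] := dP.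
by apply: eq_card => A; rewrite !inE; move: eE; rewrite inE => ->.
Qed.

End Counting.

(** * Sizes of color classes *)

Section ColorClasses.
Local Open Scope nat_scope.
Variables (R : realType) (V : finType) (pos : V -> 'rV[R]_2).
Variable P : {set {set V}}.
Local Notation E := (complete_edges V).
Hypothesis convp : convex_position pos.
Hypothesis dP : is_decomposition E P.
Hypothesis P3 : {in P, forall A : {set V}, #|A| = 3}.

Lemma P_colorable_bound (k : nat) : P_colorable pos E P k ->
  'C(#|V|, 2) <= 3 * (9 * k + #|V| * (#|V| %/ 11)).
Proof.
case=> c [cE cA cAB]; have [r [r_inj rV r_cross]] := convex_position_order convp.
set D := #|V| %/ 11; rewrite -(card_triangle_decomposition dP P3) leq_pmul2l //.
pose S := [set A in P | gaps_ge r D.+1 A].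
(* Colors live on edges, so a triangle gets its color through a chosen edge; the default is never
   reached on [P]. *)
pose edge A := odflt set0 [pick e in induced_edges E A].
have edgeP A : A \in P -> edge A \in induced_edges E A.
  move=> AP; rewrite /edge; case: pickP => [//|noe] /=.
  have [e] : exists e, e \in [set e : {set V} | e \subset A & #|e| == 2].
    by apply/set0Pn; rewrite -card_gt0 cards_draws P3.
  by have := noe e; rewrite !inE andbC => ->.
have class9 j : #|[set A in S | c (edge A) == j]| <= 9.
  set F := [set A in S | _]; have [->//|F0] := posnP #|F|.
  have FP A : A \in F -> A \in P by rewrite !inE => /andP[/andP[]].
  have V0 : 0 < #|V|.
    have /card_gt0P[A /FP/P3 A3] := F0.
    by apply: leq_trans (max_card A); rewrite A3.
  have : D.+1 * #|F|.+1 + 0 <= #|V|.-1.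
    apply: (noncrossing_span r_inj) => //.
    - by move=> A /FP /P3.
    - by move=> A; rewrite !inE => /andP[/andP[]].
    - move=> A B AF BF nAB.
      (* Members of one color cannot meet; this yields both disjointness and the absence of
         interleaving. *)
      have nmeet : ~ members_meet pos E A B.
        move=> meet; have AP := FP _ AF; have BP := FP _ BF.
        have := cAB A B AP BP (elimN eqP nAB) meet _ _ (edgeP A AP) (edgeP B BP).
        by move: AF BF; rewrite !inE => /andP[_ /eqP ->] /andP[_ /eqP ->].
      split.
        apply/pred0P => v /=; apply/negP => /andP[vA vB].
        by apply: nmeet; left; exists v.
      move=> [a [b [x [d [[aA bB xA dB] abx xd]]]]]; apply: nmeet; right.
      have sub u v (C : {set V}) : u \in C -> v \in C -> r u < r v ->
          [set u; v] \in induced_edges E C.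
        move=> uC vC uv; rewrite !inE cards2; apply/andP; split.
          by rewrite eqSS eqb1; apply: contraTneq uv => ->; rewrite ltnn.
        by apply/subsetP => w /set2P[] ->.
      exists [set a; x], [set b; d]; split; last exact: r_cross.
        by apply: sub => //; lia.
      by apply: sub => //; lia.
    - by move=> A v _ _; apply/andP; split; rewrite // -ltnS prednK ?rV.
  (* With [D.+1 * #|F|.+1 < #|V| < 11 * D.+1], it follows that [#|F|.+1 < 11]. *)
  have := ltn_ceil #|V| (isT : 0 < 11); rewrite -/D => lt_D spanF.
  rewrite -2!ltnS -(ltn_pmul2l (isT : 0 < D.+1)).
  by move: lt_D spanF; clear; lia.
have S_le : #|S| <= 9 * k.
  rewrite mulnC -[k in k * 9]card_ord -sum_nat_const.
  apply: (@leq_trans (\sum_(j < k) #|[set A in S | c (edge A) == j]|)); last first.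
    by apply: leq_sum => j _; apply: class9.
  rewrite -sum1_card.
  rewrite (eq_bigr (fun j : 'I_k => \sum_(A in S | c (edge A) == j) 1)); last first.
    by move=> j _; rewrite -sum1_card; apply: eq_bigl => A; rewrite inE.
  rewrite (exchange_big_dep (mem S)) /=; last by move=> ? ? _ /andP[].
  apply: leq_sum => A AS.
  have AP : A \in P by move: AS; rewrite inE => /andP[].
  have ck : c (edge A) < k.
    by apply: cE; have := edgeP A AP; rewrite inE => /andP[].
  by rewrite (bigD1 (Ordinal ck)) //= AS eqxx.
have := card_short_members r_inj D (decomposition_uniq dP).
rewrite -(cardsID [set A | gaps_ge r D.+1 A] P) => short_le.
apply: leq_add.
  by apply: leq_trans S_le; apply/eq_leq/eq_card => A; rewrite !inE.
by apply: leq_trans short_le; apply/eq_leq/eq_card => A; rewrite !inE andbC.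
Qed.

End ColorClasses.

Theorem theorem3p3 (R : realType) :
  exists C : R,
  forall (n : nat) (pos : 'I_n -> 'rV[R]_2) (P : {set {set 'I_n}})
    (dP : is_decomposition (complete_edges 'I_n) P),
    convex_position pos ->
    (forall A, A \in P -> is_triangle (complete_edges 'I_n) A) ->
    n%:R ^+ 2 / 119%:R - C * n%:R <= (chromatic_index pos dP)%:R :> R.
Proof.
exists 1 => n pos P dP convp Ptri.
have P3 : {in P, forall A : {set 'I_n}, #|A| = 3%N} by move=> A /Ptri[].
rewrite /chromatic_index; case: ex_minnP => k /asboolP col_k _.
have := P_colorable_bound convp dP P3 col_k; rewrite card_ord => le_k.
(* This is [le_k] times 22, with [n %/ 11] bounded by [n / 11]. It says
   [5 * n ^ 2 <= 594 * k + 11 * n], so the linear error is at most [11 * n / 594] and [C = 1]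
   suffices. *)
have : (11 * (n * n) <= 6 * (99 * k + n * n) + 11 * n)%N.
  have : (n * (n %/ 11) * 11 <= n * n)%N by rewrite -mulnA leq_mul // leq_divM.
  have := mul_bin_diag n 1; rewrite bin1; case: (n) le_k => [|m] /=; first by lia.
  by rewrite !mulSn !mulnS; lia.
rewrite -(ler_nat R) !(natrD, natrM) => le_kR.
have n0 : 0 <= n%:R :> R by rewrite ler0n.
have n2 : 0 <= n%:R * n%:R :> R by rewrite mulr_ge0.
rewrite expr2; lra.
Qed.
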